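(* Every second-countable $\omega$-well-filtered space is sober.
   Context: For a $T_0$ space $X$, the specialization order is $x\le y$ iff $x\in\overline{\{y\}}$; a subset is saturated if it is an upper set in this order (equivalently, an intersection of open sets). $\mathsf{K}(X)$ is the set of all nonempty compact saturated subsets of $X$. A family $\mathcal K\subseteq\mathsf K(X)$ is filtered if it is nonempty and for all $K_1,K_2\in\mathcal K$ there is $K_3\in\mathcal K$ with $K_3\subseteq K_1\cap K_2$. A $T_0$ space $X$ is $\omega$-well-filtered if for every countable filtered family $\{K_i: i<\omega\}\subseteq\mathsf K(X)$ and every open $U\subseteq X$, $\bigcap_{i<\omega}K_i\subseteq U$ implies $K_{i_0}\subseteq U$ for some $i_0<\omega$. A nonempty set $A\subseteq X$ is irreducible if whenever $A\subseteq F_1\cup F_2$ with $F_1,F_2$ closed, then $A\subseteq F_1$ or $A\subseteq F_2$. $X$ is sober if every irreducible closed subset of $X$ is $\overline{\{a\}}$ for a unique $a\in X$. *)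

(* Defs.v *)
From mathcomp Require Import all_boot all_order all_algebra.
From mathcomp Require Import all_classical.
From mathcomp Require Import topology.

Set Implicit Arguments.
Unset Strict Implicit.
Unset Printing Implicit Defensive.

Local Open Scope classical_set_scope.

Definition specialization (X : topologicalType) (x y : X) : Prop :=
  closure [set y] x.

Definition saturated (X : topologicalType) (A : set X) : Prop :=
  forall x y : X, specialization x y -> A x -> A y.

Definition compact_saturated (X : topologicalType) : set (set X) :=
  [set K | [/\ K !=set0, compact K & saturated K]].

Definition filtered_family (X : Type) (KK : set (set X)) : Prop :=
  KK !=set0 /\
  forall K1 K2 : set X, KK K1 -> KK K2 ->
    exists2 K3 : set X, KK K3 & K3 `<=` K1 `&` K2.

(* The indexing by nat may repeat sets and need not be decreasing. *)
Definition omega_well_filtered (X : topologicalType) : Prop :=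
  kolmogorov_space X /\
  forall (K : nat -> set X) (U : set X),
    range K `<=` @compact_saturated X ->
    filtered_family (range K) ->
    open U ->
    \bigcap_i K i `<=` U -> exists i : nat, K i `<=` U.

Definition irreducible (X : topologicalType) (A : set X) : Prop :=
  A !=set0 /\
  forall F1 F2 : set X, closed F1 -> closed F2 ->
    A `<=` F1 `|` F2 -> A `<=` F1 \/ A `<=` F2.

Definition sober (X : topologicalType) : Prop :=
  forall A : set X, irreducible A -> closed A ->
    exists! a : X, A = closure [set a].

(* Main.v *)
Require Import Defs.
From mathcomp Require Import all_boot all_order all_algebra.
From mathcomp Require Import all_classical.
From mathcomp Require Import topology.

(** Let [A] be irreducible and closed in a second-countable space. The basic
open sets meeting [A] are countably many and, by irreducibility, any finitely
many of them have a common point in [A]; so there is a sequence [x] in [A] that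
eventually enters every open set meeting [A]. The saturations of the tails of
[x] are compact and decreasing. By omega-well-filteredness their intersection
cannot lie in the complement of [A], hence contains a point [a] of [A]. Any open
set meeting [A] contains a tail of [x], hence [a]: [A] is the closure of [a]. *)

Set Implicit Arguments.
Unset Strict Implicit.
Unset Printing Implicit Defensive.

Local Open Scope classical_set_scope.

Section SpecializationOrder.
Variable X : topologicalType.
Implicit Types (x y z : X) (U V A : set X).

Lemma specialization_open x y U :
  specialization x y -> open U -> U x -> U y.
Proof.
move=> xy oU Ux.
by have [_ [-> ]] := xy U (open_nbhs_nbhs (conj oU Ux)).
Qed.

Lemma specialization_refl x : specialization x x.
Proof. exact: subset_closure. Qed.

Lemma specialization_trans y x z :
  specialization x y -> specialization y z -> specialization x z.
Proof.
move=> xy yz B; rewrite nbhsE => -[U [oU Ux] UB].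
exists z; split=> //; apply: UB.
exact: specialization_open yz oU (specialization_open xy oU Ux).
Qed.

Lemma specialization_anti x y :
  kolmogorov_space X -> specialization x y -> specialization y x -> x = y.
Proof.
move=> T0 xy yx; apply/eqP/negPn/negP => /T0[B].
rewrite !inE => -[[Bx By]|[By Bx]].
- by have [_ [-> ]] := xy B Bx.
- by have [_ [-> ]] := yx B By.
Qed.

(** If [A] missed [U] and [V] jointly, the closed complements of [U] and [V] would cover [A], so one
    of them alone would contain it. *)
Lemma irreducible_openI A U V : irreducible A -> open U -> open V ->
  A `&` U !=set0 -> A `&` V !=set0 -> A `&` (U `&` V) !=set0.
Proof.
move=> [_ irrA] oU oV [u [Au Uu]] [v [Av Vv]].
apply: contrapT => nUV.
have AUV : A `<=` ~` U `|` ~` V.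
  by move=> y Ay; rewrite -setCI => UVy; apply: nUV; exists y.
have [AU|AV] := irrA _ _ (open_closedC oU) (open_closedC oV) AUV.
- exact: AU Uu.
- exact: AV Vv.
Qed.

Lemma irreducible_dense_sequence A : @second_countable X -> irreducible A ->
  exists x : nat -> X, (forall n, A (x n)) /\
    forall U, open U -> A `&` U !=set0 ->
      exists m, forall k, (m <= k)%N -> U (x k).
Proof.
move=> [B /pfcard_geP cB [oB bB]] irrA.
have [[a Aa] _] := irrA.
case: cB => [B0|[f]].
  (* An empty base would leave the point [a] without a basic neighbourhood. *)
  by have [V [/=]] := bB a setT (@filterT _ (nbhs a) _); rewrite B0.
have W n : exists W : set X, [/\ open W, A `&` W !=set0 &
    forall i, (i < n)%N -> open (f i) -> A `&` f i !=set0 -> W `<=` f i].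
  elim: n => [|n [W [oW AW Wf]]].
    by exists setT; split=> //; [exact: openT|exists a].
  (* [W] is cut down by [f n] only when [f n] is open and meets [A]; irreducibility then keeps it
     meeting [A]. *)
  have [[ofn Afn]|nfn] := pselect (open (f n) /\ A `&` f n !=set0).
    exists (W `&` f n); split; first exact: openI.
      exact: irreducible_openI.
    move=> i; rewrite ltnS leq_eqVlt => /orP[/eqP-> _ _ y []//|lin ofi Afi].
    by move=> y [Wy _]; exact: Wf i lin ofi Afi y Wy.
  exists W; split=> // i; rewrite ltnS leq_eqVlt => /orP[/eqP-> ofn Afn|].
    by case: nfn.
  exact: Wf.
have xP n : exists y, A y /\
    forall i, (i < n)%N -> open (f i) -> A `&` f i !=set0 -> f i y.
  have [V [_ [y [Ay Vy]] Vf]] := W n.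
  by exists y; split=> // i lin ofi Afi; exact: Vf i lin ofi Afi y Vy.
have [x xE] := choice xP.
exists x; split=> [n|U oU [y [Ay Uy]]]; first by have [] := xE n.
have [V /= [BV Vy] VU] := bB y U (open_nbhs_nbhs (conj oU Uy)).
have [i _ fiV] := @surj _ _ _ _ f V BV.
(* [x k] obeys the sets [f i] with [i < k] strictly, hence the successor. *)
exists i.+1 => k ik; apply: VU.
have [_ xk] := xE k; rewrite -fiV; apply: xk => //; rewrite fiV.
- exact: oB.
- by exists y.
Qed.

Definition up_tail (x : nat -> X) n : set X :=
  [set y | exists2 k, (n <= k)%N & specialization (x k) y].

Lemma up_tail_saturated (x : nat -> X) n : saturated (up_tail x n).
Proof.
move=> y z yz [k nk xy]; exists k => //; exact: specialization_trans xy yz.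
Qed.

Lemma up_tailS (x : nat -> X) m n :
  (m <= n)%N -> up_tail x n `<=` up_tail x m.
Proof. by move=> mn y [k nk xy]; exists k => //; exact: leq_trans nk. Qed.

Lemma up_tail_subset (x : nat -> X) n U : open U ->
  (forall k, (n <= k)%N -> U (x k)) -> up_tail x n `<=` U.
Proof.
by move=> oU Ux y [k nk xy]; exact: specialization_open xy oU (Ux k nk).
Qed.

(** The sequence converges to its own term [x n]: a neighbourhood of [x n] absorbs all but finitely
    many terms together with the points above them, and the points above a single term form a
    compact set. *)
Lemma up_tail_compact (x : nat -> X) n :
  (forall U, open U -> U (x n) -> exists m, forall k, (m <= k)%N -> U (x k)) ->
  compact (up_tail x n).
Proof.
move=> cvx F FF FK; apply: contrapT => ncl.
(* It suffices to look for a cluster point among the terms [x k] themselves. *)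
have sep k : (n <= k)%N -> exists2 G, F G & exists U,
    [/\ open U, U (x k) & G `&` U = set0].
  move=> nk; apply: contrapT => nsep; apply: ncl; exists (x k); split.
    by exists k => //; exact: specialization_refl.
  move=> G V FG; rewrite nbhsE => -[U [oU Ux] UV].
  have /set0P[y [Gy Uy]] : G `&` U != set0.
    by apply/eqP => GU; apply: nsep; exists G => //; exists U.
  by exists y; split=> //; exact: UV.
have [G FG [U [oU Ux GU]]] := sep n (leqnn n).
have [m mU] := cvx U oU Ux.
(* [H] is a finite intersection of members of [F], one for each term not yet absorbed by [U]. *)
have [H FH Hsep] : exists2 H, F H & forall k y, (n <= k < m)%N ->
    specialization (x k) y -> ~ H y.
  elim: {mU} m => [|m [H FH HP]].
    by exists setT; [exact: filterT|move=> k y; rewrite ltn0 andbF].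
  have [nm|mn] := leqP n m; last first.
    exists H => // k y /andP[nk]; rewrite ltnS => km.
    by have := leq_trans mn (leq_trans nk km); rewrite ltnn.
  have [G' FG' [V [oV Vx GV]]] := sep m nm.
  exists (H `&` G'); first exact: filterI.
  move=> k y /andP[nk]; rewrite ltnS leq_eqVlt => /orP[/eqP->|km] xy [Hy Gy].
    have : (G' `&` V) y by split=> //; exact: specialization_open xy oV Vx.
    by rewrite GV.
  by apply: (HP k y) => //; rewrite nk.
have [y [[Ky Gy] Hy]] := filter_ex (filterI (filterI FK FG) FH).
have [k nk xy] := Ky.
have [km|mk] := ltnP k m; first by apply: (Hsep k y) => //; rewrite nk.
have : (G `&` U) y by split=> //; exact: specialization_open xy oU (mU k mk).
by rewrite GU.
Qed.

End SpecializationOrder.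

Theorem corollary6p11 (X : topologicalType) :
  @second_countable X -> omega_well_filtered X -> sober X.
Proof.
move=> scX [T0 wfX] A irrA cA.
have [x [Ax xU]] := irreducible_dense_sequence scX irrA.
have [a [Aa Ka]] : exists a, A a /\ forall n, up_tail x n a.
  apply: contrapT => nA.
  have [|||i KiA] := wfX (up_tail x) (~` A) _ _ (closed_openC cA).
  - move=> _ [n _ <-]; split; last exact: up_tail_saturated.
      by exists (x n); exists n => //; exact: specialization_refl.
    (* An open set containing [x n] meets [A] there, so it contains a tail. *)
    by apply: up_tail_compact => U oU Ux; apply: xU => //; exists (x n).
  - split; first by exists (up_tail x 0); exists 0%N.
    move=> _ _ [m _ <-] [n _ <-]; exists (up_tail x (maxn m n)).
      by exists (maxn m n).
    by move=> y Ky; split; apply: up_tailS Ky; rewrite ?leq_maxl ?leq_maxr.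
  - by move=> a Ka Aa; apply: nA; exists a; split=> // n; exact: Ka.
  (* The term [x i] lies both in its own saturated tail and in [A]. *)
  - apply: (KiA (x i)) (Ax i); exists i => //; exact: specialization_refl.
have AE : A = closure [set a].
  apply/seteqP; split=> [y Ay B|].
    rewrite nbhsE => -[U [oU Uy] UB].
    have [|m mU] := xU U oU; first by exists y.
    exists a; split=> //; apply: UB; exact: up_tail_subset mU _ (Ka m).
  by move/closure_id: cA => ->; apply: closureS => _ ->.
(* Points with the same closure specialize to each other, so they agree by the T0 axiom. *)
exists a; split=> // b AbE; apply: specialization_anti T0 _ _.
- by rewrite /specialization -AbE.
- by rewrite /specialization -AE AbE; exact: subset_closure.
Qed.
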